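(* Let $G$ and $H$ be two finite simple graphs with disjoint vertex sets, having $m$ and $n$ vertices, respectively ($m,n\geq 1$). Then $\mathrm{pd}(R/I(G*H))=m+n-1$.
   Context: $\mathbb{K}$ is a field. For a finite simple graph $L$, the edge ideal $I(L)$ is generated by the monomials $xy$ with $\{x,y\}\in E(L)$ in the polynomial ring $R$ over $\mathbb{K}$ whose variables are the vertices of $L$. The projective dimension $\mathrm{pd}(M)$ of a finitely generated graded $R$-module $M$ is the length of its minimal graded free resolution, i.e. $\mathrm{pd}(M)=\max\{i\mid\beta_{i,j}(M)\neq 0\text{ for some }j\}$. For graphs $G,H$ with $V(G)\cap V(H)=\emptyset$, the product $G*H$ is the graph on $V(G)\cup V(H)$ with edge set $E(G)\cup E(H)\cup\{\{x,y\}\mid x\in V(G),\ y\in V(H)\}$. *)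

(* Defs.v *)
From HB Require Import structures.
From mathcomp Require Import all_boot all_order all_algebra.
From mathcomp Require Import generic_quotient ring_quotient.
From mathcomp Require Import boolp.
From mathcomp Require Import mpoly.

Set Implicit Arguments.
Unset Strict Implicit.
Unset Printing Implicit Defensive.

Import GRing.Theory.

Local Open Scope ring_scope.

Record sgraph (V : finType) := SGraph {
  adj : rel V;
  adj_sym : ssrbool.symmetric adj;
  adj_irr : irreflexive adj
}.

(* Disjointness of the two vertex sets is built into the sum type. *)
Section GraphProduct.
Variables (V W : finType) (G : sgraph V) (H : sgraph W).

Definition prod_adj : rel (V + W)%type := fun a b =>
  match a, b with
  | inl x, inl y => adj G x y
  | inr x, inr y => adj H x y
  | _, _ => true
  end.

Lemma prod_adj_sym : ssrbool.symmetric prod_adj.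
Proof. by case=> x [] y //=; apply: adj_sym. Qed.

Lemma prod_adj_irr : irreflexive prod_adj.
Proof. by case=> x /=; apply: adj_irr. Qed.

Definition graph_prod : sgraph (V + W)%type := SGraph prod_adj_sym prod_adj_irr.
End GraphProduct.

Section QuotientModule.
Variables (R : comNzRingType) (I : idealr R).

Definition ideal_quot_scale (a : R) (x : {ideal_quot I}) : {ideal_quot I} :=
  (\pi_{ideal_quot I} a)%qT * x.

Fact ideal_quot_scaleA a b x :
  ideal_quot_scale a (ideal_quot_scale b x) = ideal_quot_scale (a * b) x.
Proof. by rewrite /ideal_quot_scale mulrA rmorphM. Qed.

Fact ideal_quot_scale1 : left_id 1 ideal_quot_scale.
Proof. by move=> x; rewrite /ideal_quot_scale rmorph1 mul1r. Qed.

Fact ideal_quot_scaleDr : right_distributive ideal_quot_scale +%R.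
Proof. by move=> a x y; rewrite /ideal_quot_scale mulrDr. Qed.

Fact ideal_quot_scaleDl x :
  {morph ideal_quot_scale^~ x : a b / a + b >-> a + b}.
Proof. by move=> a b; rewrite /ideal_quot_scale rmorphD mulrDl. Qed.

HB.instance Definition _ := GRing.Zmodule_isLmodule.Build R {ideal_quot I}
  ideal_quot_scaleA ideal_quot_scale1 ideal_quot_scaleDr ideal_quot_scaleDl.
End QuotientModule.

Definition ideal_gen (R : comNzRingType) (S : R -> Prop) (p : R) : Prop :=
  exists s : seq (R * R),
    (forall u, u \in s -> S u.2) /\ p = \sum_(u <- s) u.1 * u.2.

Section EdgeIdeal.
Variables (K : fieldType) (V : finType) (L : sgraph V).

Definition vertex_var (v : V) : {mpoly K[#|V|]} := 'X_(enum_rank v).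

Definition edge_monomial (p : {mpoly K[#|V|]}) : Prop :=
  exists x y, adj L x y /\ p = vertex_var x * vertex_var y.

Definition edge_ideal : {pred {mpoly K[#|V|]}} :=
  fun p => `[< ideal_gen edge_monomial p >].

Lemma edge_idealP p : reflect (ideal_gen edge_monomial p) (p \in edge_ideal).
Proof. exact: asboolP. Qed.

Fact edge_ideal_closed : idealr_closed edge_ideal.
Proof.
split.
- by apply/edge_idealP; exists [::]; split=> //; rewrite big_nil.
- apply/negP => /edge_idealP[s [Ss e1]].
  have /eqP := congr1 (fun p : {mpoly K[_]} => p.@[fun _ => 0]) e1.
  rewrite raddf_sum /= meval1 big_seq big1 ?oner_eq0 // => u /Ss[x [y [_ ->]]].
  by rewrite !mevalM /vertex_var mevalXU mul0r mulr0.
- move=> a p q /edge_idealP[s [Ss ->]] /edge_idealP[t [St ->]].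
  apply/edge_idealP; exists ([seq (a * u.1, u.2) | u <- s] ++ t); split.
    by move=> u; rewrite mem_cat => /orP[/mapP[w /Ss ? ->] //|/St].
  rewrite big_cat big_map mulr_sumr /=; congr (_ + _).
  by apply: eq_bigr => u _; rewrite mulrA.
Qed.

HB.instance Definition _ :=
  isIdealr.Build {mpoly K[#|V|]} edge_ideal edge_ideal_closed.
End EdgeIdeal.

Arguments edge_ideal K {V} L.

Section GradedResolutions.
Variables (K : fieldType) (n : nat).
Local Notation R := {mpoly K[n]}.

Definition zhomog (t : int) (p : R) : Prop :=
  match t with
  | Posz k => p \is k.-homog
  | Negz _ => p = 0
  end.

(* The images of the homogeneous polynomials of degree t in R/I. *)
Definition quot_deg (I : idealr R) (t : int) (x : {ideal_quot I}) : Prop :=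
  exists p : R, zhomog t p /\ x = (\pi_{ideal_quot I} p)%qT.

(* Elements of degree t in the graded free module \bigoplus_j R(- a j). *)
Definition free_deg (r : nat) (a : 'I_r -> int) (t : int) (v : 'rV[R]_r) :
  Prop := forall j, zhomog (t - a j) (v 0 j).

(* F_i = \bigoplus_j R(- fdeg i j) is a module of row vectors, and the         *)
(* differential F_{i+1} -> F_i is right multiplication by fdiff i.            *)
Record free_seq := FreeSeq {
  frank : nat -> nat;
  fdeg : forall i, 'I_(frank i) -> int;
  fdiff : forall i, 'M[R]_(frank i.+1, frank i)
}.

(* M is an R-module whose piece of degree t is given by the predicate Mdeg t. *)
Section Resolutions.
Variables (M : lmodType R) (Mdeg : int -> M -> Prop).

Record graded_free_resolution (F : free_seq)
    (eps : {linear 'rV[R]_(frank F 0) -> M}) : Prop := {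
  gfr_eps_deg : forall t v, free_deg (@fdeg F 0) t v -> Mdeg t (eps v);
  gfr_diff_deg : forall i t (v : 'rV[R]_(frank F i.+1)),
    free_deg (@fdeg F i.+1) t v ->
    free_deg (@fdeg F i) t (v *m fdiff F i);
  gfr_eps_surj : forall x, exists v, eps v = x;
  gfr_exact0 : forall v, eps v = 0 <-> exists w, v = w *m fdiff F 0;
  gfr_exact : forall i (v : 'rV[R]_(frank F i.+1)),
    v *m fdiff F i = 0 <-> exists w, v = w *m fdiff F i.+1
}.

(* All differentials have entries in the ideal generated by the variables. *)
Definition minimal_seq (F : free_seq) : Prop :=
  forall i j k, (fdiff F i j k)@_0%MM = 0.

Definition minimal_graded_free_resolution (F : free_seq) : Prop :=
  minimal_seq F /\
  exists eps : {linear 'rV[R]_(frank F 0) -> M}, graded_free_resolution eps.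

Definition betti (F : free_seq) (i : nat) (j : int) : nat :=
  #|[set k : 'I_(frank F i) | fdeg k == j]|.

Definition max_betti_index (F : free_seq) (p : nat) : Prop :=
  (exists j, betti F p j <> 0%N) /\
  (forall i j, betti F i j <> 0%N -> (i <= p)%N).

(* pd(M) = p; existence is required so that the universal part is not vacuous. *)
Definition has_pd (p : nat) : Prop :=
  (exists F, minimal_graded_free_resolution F) /\
  (forall F, minimal_graded_free_resolution F -> max_betti_index F p).
End Resolutions.
End GradedResolutions.

Arguments quot_deg {K n} I t x.
Arguments has_pd {K n} M Mdeg p.

(* Main.v *)
Require Import Defs.
From HB Require Import structures.
From mathcomp Require Import all_boot all_order all_algebra.
From mathcomp Require Import generic_quotient ring_quotient.
From mathcomp Require Import boolp.
From mathcomp Require Import mpoly.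

Set Implicit Arguments.
Unset Strict Implicit.
Unset Printing Implicit Defensive.

Import Order.TTheory GRing.Theory.

Local Open Scope ring_scope.

(** Write [R] for the polynomial ring in the [N = m + n] vertices of the join and
    [I] for its edge ideal.

    The depth of [R/I] is one, so its projective dimension is [N - 1] by the
    Auslander-Buchsbaum formula; the argument below proves both facts on elements
    of a given resolution. The sum [l] of all variables is a nonzerodivisor on
    [R/I]: the ideal [I] is the intersection of the kernels of the maps that set
    to zero the variables outside an independent set, and [l] survives all these
    maps for nonempty sets ([sum_vars_edge_regular]). Modulo [l] the depth drops to
    zero: the sum [u] of the vertices of [G] is killed by every vertex of [H]
    since all the edges between the two sides are present, and it equals, up to
    sign, the sum of the vertices of [H], so it is killed by every vertex of [G]
    too ([left_sum_socle]); and [u] is not zero in [R/(I + l R)]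
    ([left_sum_not_multiple]).

    Extend [l] to an [R]-regular sequence [f 0, ..., f N.-1] generating the
    irrelevant ideal ([regular_seq_sum_vars]). Reduce a free resolution [F] of
    [R/I], augmented by [R/I] itself, modulo longer and longer initial segments of
    the sequence. Each new term is regular on the modules concerned, so homology
    stays confined to low degrees ([homology_vanishes]), and the connecting
    homomorphisms push the class of [u] up by one degree at every step, until it
    is a nonzero element of [F (N - 1)] ([socle_climbs]). If [F] is minimal, its
    differentials vanish modulo the whole sequence, so the vanishing of homology
    in degrees [N] and above says that [F i = 0] for [N <= i]
    ([minimal_frank_eq0]).

    A minimal graded free resolution exists because graded submodules of free
    modules have finitely many homogeneous generators: Dickson's lemma gives
    Hilbert's basis theorem by division with remainder, and the modules follow by
    induction on the rank ([submod_generated]). Taking the least possible number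
    of homogeneous generators at each step makes the resolution minimal
    ([minimal_generators]). *)

(** * Regular sequences and exact complexes *)

Section RegularSequences.
Variables (R : comNzRingType) (f : nat -> R).

(** The submodule [(f 0, ..., f k.-1) M]. *)
Definition seq_mult (k : nat) (M : lmodType R) (v : M) : Prop :=
  exists c : nat -> M, v = \sum_(i < k) f i *: c i.

Definition regular_at (k : nat) (M : lmodType R) : Prop :=
  forall v : M, seq_mult k (f k *: v) -> seq_mult k v.

Lemma seq_mult0 (M : lmodType R) (v : M) : seq_mult 0 v <-> v = 0.
Proof.
split=> [[c ->]|->]; first by rewrite big_ord0.
by exists (fun=> 0); rewrite big_ord0.
Qed.

Lemma seq_multD k (M : lmodType R) (v w : M) :
  seq_mult k v -> seq_mult k w -> seq_mult k (v + w).
Proof.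
move=> [c ->] [c' ->]; exists (fun i => c i + c' i).
by rewrite -big_split; apply: eq_bigr => i _; rewrite scalerDr.
Qed.

Lemma seq_multZ k (M : lmodType R) (a : R) (v : M) :
  seq_mult k v -> seq_mult k (a *: v).
Proof.
move=> [c ->]; exists (fun i => a *: c i); rewrite scaler_sumr.
by apply: eq_bigr => i _; rewrite !scalerA mulrC.
Qed.

Lemma seq_multN k (M : lmodType R) (v : M) : seq_mult k v -> seq_mult k (- v).
Proof. by rewrite -scaleN1r; apply: seq_multZ. Qed.

Lemma seq_multB k (M : lmodType R) (v w : M) :
  seq_mult k v -> seq_mult k w -> seq_mult k (v - w).
Proof. by move=> hv /seq_multN; apply: seq_multD. Qed.

Lemma seq_multS k (M : lmodType R) (v : M) :
  seq_mult k.+1 v <-> exists c q, seq_mult k c /\ v = c + f k *: q.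
Proof.
split=> [[c ->]|[_ [q [[c ->] ->]]]].
  exists (\sum_(i < k) f i *: c i), (c k); split; last by rewrite big_ord_recr.
  by exists c.
exists (fun i => if i == k then q else c i); rewrite big_ord_recr /= eqxx.
by congr (_ + _); apply: eq_bigr => i _; rewrite ltn_eqF.
Qed.

Lemma seq_mult_widen k (M : lmodType R) (v : M) :
  seq_mult k v -> seq_mult k.+1 v.
Proof. by move=> hv; apply/seq_multS; exists v, 0; rewrite scaler0 addr0. Qed.

Lemma seq_mult_last k (M : lmodType R) (v : M) : seq_mult k.+1 (f k *: v).
Proof.
apply/seq_multS; exists 0, v; rewrite add0r; split=> //.
by exists (fun=> 0); rewrite big1 // => i _; rewrite scaler0.
Qed.

Lemma seq_mult_linear k (M M' : lmodType R) (h : {linear M -> M'}) (v : M) :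
  seq_mult k v -> seq_mult k (h v).
Proof.
move=> [c ->]; exists (fun i => h (c i)); rewrite linear_sum.
by apply: eq_bigr => i _; rewrite linearZ.
Qed.

Lemma seq_mult_row k r (v : 'rV[R]_r) :
  (forall j, seq_mult k (v 0 j : R^o)) -> seq_mult k v.
Proof.
move=> /fin_all_exists [c hc]; exists (fun i => \row_j c j i).
apply/rowP => j; rewrite hc summxE; apply: eq_bigr => i _.
by rewrite !mxE.
Qed.

Lemma regular_at_row k r : regular_at k R^o -> regular_at k 'rV[R]_r.
Proof.
move=> reg v [c hc]; apply: seq_mult_row => j; apply: reg.
exists (fun i => c i 0 j).
have -> : f k *: (v 0 j : R^o) = (f k *: v) 0 j by rewrite mxE.
by rewrite hc summxE; apply: eq_bigr => i _; rewrite mxE.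
Qed.

Section ExactComplex.
Variables (A : nat -> lmodType R) (d : forall i, {linear A i.+1 -> A i}).
Hypothesis exactA : forall i v, d i v = 0 <-> exists w, v = d i.+1 w.
Variable N : nat.
Hypothesis regA : forall k i, (k < N)%N -> (k <= i)%N -> regular_at k (A i).

(** For a cycle of the complex reduced modulo [(f 0, ..., f k.-1)], its homology
    class is zero. *)
Definition bounds k i (v : A i) : Prop :=
  exists c w, seq_mult k c /\ v = c + d i w.

Lemma dd0 i (w : A i.+2) : d i (d i.+1 w) = 0.
Proof. by apply/exactA; exists w. Qed.

(** This is the long exact sequence of multiplication by [f k], on elements. If
    [d v] is [f k *: w] modulo the earlier terms, then [d w] vanishes modulo them
    because [f k] is regular, so by induction [w] is a boundary [d w'], and
    [v - f k *: w'] is a cycle modulo the earlier terms only. *)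
Lemma homology_vanishes k i (v : A i.+1) : (k <= N)%N -> (k <= i)%N ->
  seq_mult k (d i v) -> bounds k v.
Proof.
elim: k i v => [|k IH] i v kN ki.
  move=> /seq_mult0/exactA[w ->]; exists 0, w; rewrite add0r; split=> //.
  exact/seq_mult0.
case: i v ki => // i v ki /seq_multS[c [w [hc dv]]].
have dw : seq_mult k (d i w).
  apply: regA => //; rewrite -linearZ_LR.
  have -> : d i (f k *: w) = - d i c.
    by apply/eqP; rewrite -addr_eq0 addrC -linearD -dv dd0.
  exact/seq_multN/seq_mult_linear.
have [c' [w' [hc' ew]]] := IH _ _ (ltnW kN) ki dw.
have /(IH _ _ (ltnW kN) (leqW ki)) : seq_mult k (d i.+1 (v - f k *: w')).
  rewrite linearB linearZ_LR dv ew scalerDr addrA addrK.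
  by apply: seq_multD => //; apply: seq_multZ.
move=> [c2 [w2 [hc2 ev]]]; exists (c2 + f k *: w'), w2; split.
  by apply: seq_multD; [exact: seq_mult_widen | exact: seq_mult_last].
by rewrite addrAC -ev subrK.
Qed.

Definition socle_class k (v : A k) : Prop :=
  ~ bounds k v /\ forall j, (j < N)%N -> bounds k (f j *: v).

(** The connecting homomorphism is injective on classes killed by [f k]: writing
    [f k *: v = c + d w] with [c] in the earlier multiples, the class of [v] goes to
    that of [w]. That the other [f j] kill [w] as well needs the vanishing of the
    homology one degree above [v], applied to [f j *: w - f k *: wj]. *)
Lemma socle_class_step k (v : A k) : (0 < k < N)%N -> socle_class v ->
  exists w : A k.+1, socle_class w.
Proof.
move=> /andP[k0 kN] [nv sv]; have [c [w [hc ev]]] := sv k kN.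
exists w; split=> [[c2 [w2 [/seq_multS[c1 [w1 [hc1 ec2]] ew]]]]|j jN].
  apply: nv; exists (v - d k w1), w1; rewrite subrK; split=> //.
  apply: regA => //; rewrite scalerBr ev ew ec2 !linearD dd0 linearZ_LR /=.
  rewrite addr0 addrA addrK; apply: seq_multD => //; exact: seq_mult_linear.
have [cj [wj [hcj evj]]] := sv j jN.
have /homology_vanishes : seq_mult k (d k (f j *: w - f k *: wj)).
  have -> : d k (f j *: w - f k *: wj) = f k *: cj - f j *: c.
    rewrite linearB !(linearZ_LR (d k)).
    have -> : d k w = f k *: v - c by rewrite ev addrAC subrr add0r.
    have -> : d k wj = f j *: v - cj by rewrite evj addrAC subrr add0r.
    rewrite !scalerBr !scalerA (mulrC (f j)).
    by rewrite opprB addrC addrA subrK.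
  by apply: seq_multB; apply: seq_multZ.
move=> /(_ (ltnW kN) (leqnn k)) [c3 [w3 [hc3 e3]]].
exists (c3 + f k *: wj), w3; split.
  by apply: seq_multD; [exact: seq_mult_widen | exact: seq_mult_last].
by rewrite addrAC -e3 subrK.
Qed.

(** A socle element of [A 0 / f 0 A 0], lifted to [A 1], is a class for the sequence
    of length one; the connecting homomorphisms do the rest. *)
Lemma socle_climbs (u : A 0%N) : (0 < N)%N ->
  ~ (exists x, u = f 0%N *: x) ->
  (forall j, (j < N)%N -> exists x, f j *: u = f 0%N *: x) ->
  (forall x : A 0, exists v, d 0%N v = x) ->
  exists w : A N, w != 0.
Proof.
move=> N0 nu su surj; have [v dv] := surj u.
have one (M : lmodType R) (x : M) : seq_mult 1 x <-> exists y, x = f 0%N *: y.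
  split=> [/seq_multS[c [q [/seq_mult0 -> ->]]]|[y ->]].
    by exists q; rewrite add0r.
  exact: seq_mult_last.
have s1 : @socle_class 1 v.
  split=> [[c [w [/one[y ->] ev]]]|j jN].
    by apply: nu; exists (d 0%N y); rewrite -dv ev linearD dd0 addr0 linearZ.
  have [x ex] := su j jN; have [y dy] := surj x.
  have /exactA[w ew] : d 0%N (f j *: v - f 0%N *: y) = 0.
    by rewrite linearB !(linearZ_LR (d 0%N)) dv dy ex subrr.
  exists (f 0%N *: y), w; split; first by apply/one; exists y.
  by rewrite -ew addrC subrK.
have climb k : (0 < k <= N)%N -> exists w : A k, socle_class w.
  elim: k => // -[|k] IH kN; first by exists v.
  have [w sw] := IH (ltnW kN); exact: (socle_class_step _ sw).
have [|w [nw _]] := climb N; first by rewrite N0 leqnn.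
exists w; apply/eqP => w0; apply: nw; exists 0, 0; rewrite linear0 addr0.
by split=> //; exists (fun=> 0); rewrite big1 // => i _; rewrite scaler0.
Qed.

End ExactComplex.
End RegularSequences.
(** * Substitutions in polynomial rings *)

Section Substitution.
Variables (K : fieldType) (n : nat).
Local Notation R := {mpoly K[n]}.
Implicit Types (p q : R) (m : 'X_{1..n}) (S : pred 'I_n).

Lemma eq_rmorph_mpoly (T : comNzRingType) (phi psi : {rmorphism R -> T}) :
  (forall c, phi c%:MP = psi c%:MP) -> (forall i, phi 'X_i = psi 'X_i) ->
  phi =1 psi.
Proof.
move=> eqC eqX p; rewrite [p]mpolyE !raddf_sum; apply: eq_bigr => m _ /=.
rewrite -mul_mpolyC !rmorphM eqC mpolyXE_id !rmorph_prod; congr (_ * _).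
by apply: eq_bigr => i _; rewrite !rmorphXn eqX.
Qed.

Definition msubst (h : 'I_n -> R) : R -> R := mmap (@mpolyC n K) h.

HB.instance Definition _ h := GRing.RMorphism.copy (msubst h) (msubst h).

Lemma msubstX h i : msubst h 'X_i = h i.
Proof. by rewrite /msubst mmapX mmap1U. Qed.

Lemma msubstC h c : msubst h c%:MP = c%:MP.
Proof. exact: mmapC. Qed.

Lemma msubstK g h : (forall i, msubst g (h i) = 'X_i) ->
  cancel (msubst h) (msubst g).
Proof.
move=> gh p; rewrite -[RHS]/(idfun p).
apply: (eq_rmorph_mpoly (phi := msubst g \o msubst h)) => [c|i] /=.
  by rewrite !msubstC.
by rewrite msubstX gh.
Qed.

Lemma msubst_mcoeff0 h p :
  (forall i, (h i)@_0%MM = 0) -> (msubst h p)@_0%MM = p@_0%MM.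
Proof.
move=> h0; apply: (eq_rmorph_mpoly (phi := mcoeff 0 \o msubst h)) => [c|i] /=.
  by rewrite msubstC.
by rewrite msubstX h0 mcoeffX mnm1_eq0.
Qed.

(** For independent sets [S] these maps kill the edge ideal, and together they
    detect membership in it; for the sets of the variables of index at least [k]
    they detect the ideal of the first [k] variables. *)
Definition mrestr S : R -> R := msubst (fun i => if S i then 'X_i else 0).

HB.instance Definition _ S := GRing.RMorphism.copy (mrestr S) (mrestr S).

Definition msupported S m := [forall i, (m i != 0%N) ==> S i].

Lemma mrestrX S i : mrestr S 'X_i = if S i then 'X_i else 0.
Proof. exact: msubstX. Qed.

Lemma mrestrXm S m : mrestr S 'X_[m] = if msupported S m then 'X_[m] else 0.
Proof.
rewrite /mrestr /msubst mmapX /mmap1; case: ifP => [/forallP hS|].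
  rewrite mpolyXE_id; apply: eq_bigr => i _.
  have /implyP := hS i; case: (m i) => [|k] hk; first by rewrite !expr0.
  by rewrite hk.
move=> /negbT/forallPn[i]; rewrite negb_imply => /andP[mi /negbTE Si].
by rewrite (bigD1 i) //= Si expr0n (negbTE mi) mul0r.
Qed.

Lemma mcoeff_mrestr S p m :
  (mrestr S p)@_m = if msupported S m then p@_m else 0.
Proof.
have -> : mrestr S p = \sum_(m' <- msupp p) p@_m' *: mrestr S 'X_[m'].
  rewrite {1}[p]mpolyE raddf_sum; apply: eq_bigr => m' _ /=.
  by rewrite -!mul_mpolyC rmorphM /= /mrestr msubstC.
have -> : p@_m = \sum_(m' <- msupp p) p@_m' * (m' == m)%:R.
  rewrite {1}[p]mpolyE raddf_sum; apply: eq_bigr => m' _ /=.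
  by rewrite mcoeffZ mcoeffX.
rewrite raddf_sum /=; case: ifP => hm; [apply: eq_bigr|apply: big1];
  move=> m' _; rewrite mcoeffZ mrestrXm; case: ifP => hm'; rewrite ?mcoeff0 //.
- by rewrite mcoeffX.
- by case: eqP hm' => [->|]; rewrite ?hm // mulr0.
- by rewrite mcoeffX; case: eqP hm' => [->|]; rewrite ?hm // mulr0.
- by rewrite mulr0.
Qed.

(** The monomials supported in [S] keep their coefficients, so none of them occurs
    in [p], and each of the others is divisible by a variable outside [S]. *)
Lemma mrestr_kernel S p : mrestr S p = 0 ->
  exists c : 'I_n -> R, p = \sum_(i | ~~ S i) 'X_i * c i.
Proof.
move=> p0; rewrite [p]mpolyE big_seq.
apply: (big_ind (fun q => exists c : 'I_n -> R, q = \sum_(i | ~~ S i) 'X_i * c i)).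
- by exists (fun=> 0); rewrite big1 // => i _; rewrite mulr0.
- move=> _ _ [c ->] [c' ->]; exists (fun i => c i + c' i).
  by rewrite -big_split; apply: eq_bigr => i _; rewrite mulrDr.
move=> m; rewrite mcoeff_msupp => pm.
have /forallPn[i] : ~~ msupported S m.
  by apply: contraNN pm => hm; have := mcoeff_mrestr S p m; rewrite p0 hm mcoeff0 => <-.
rewrite negb_imply => /andP[mi Si].
exists (fun j => if j == i then p@_m *: 'X_[m - U_(i)] else 0).
rewrite (bigD1 i) //= eqxx big1 ?addr0 => [|j /andP[_ /negbTE ->]].
  by rewrite -scalerAr -mpolyXD addmC submK // lep1mP.
by rewrite mulr0.
Qed.

Lemma mcoeff0_sum_vars p : p@_0%MM = 0 ->
  exists c : 'I_n -> R, p = \sum_i 'X_i * c i.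
Proof.
move=> p0; have [|c pc] := @mrestr_kernel pred0 p; last by exists c.
apply/mpolyP => m; rewrite mcoeff_mrestr mcoeff0; case: ifP => // /forallP hm.
suff -> : m = 0%MM by [].
by apply/mnmP => i; rewrite mnm0E; apply/eqP; move: (hm i); rewrite implybF negbK.
Qed.

(** * A regular sequence generating the maximal ideal *)

(** Indexing by [nat] makes the variables a sequence; the default value occurs only
    past the [n] terms in use. *)
Definition mvar (k : nat) : R := if insub k is Some i then 'X_i else 0.

Lemma mvarE (i : 'I_n) : mvar i = 'X_i.
Proof. by rewrite /mvar valK. Qed.

Lemma seq_mult_mvar k p : (k <= n)%N ->
  seq_mult mvar k (p : R^o) <-> mrestr (fun i => k <= i)%N p = 0.
Proof.
move=> kn; split=> [[c ->]|/mrestr_kernel[c ->]].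
  rewrite raddf_sum big1 // => i _ /=.
  have <- : mvar (widen_ord kn i) = mvar i by [].
  by rewrite mvarE rmorphM /= mrestrX /= leqNgt ltn_ord mul0r.
pose c' k : R^o := if insub k is Some i then c i else 0.
exists c'; rewrite (big_ord_widen n (fun i => mvar i *: c' i)) //=.
by apply: eq_big => [i|i _]; rewrite -?ltnNge // mvarE /c' valK.
Qed.

Lemma mvar_regular k : (k < n)%N -> regular_at mvar k R^o.
Proof.
move=> kn p /(seq_mult_mvar _ (ltnW kn)).
have -> : mvar k = 'X_(Ordinal kn) by rewrite -mvarE.
rewrite -/('X_(Ordinal kn) * p) rmorphM /= mrestrX leqnn => /eqP.
rewrite mulf_eq0 => /orP[/eqP X0|/eqP p0]; last exact/seq_mult_mvar/p0/ltnW.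
have := congr1 (mcoeff U_(Ordinal kn)) X0.
by rewrite mcoeffXU eqxx mcoeff0 => /eqP; rewrite oner_eq0.
Qed.

Definition sum_vars : R := \sum_i 'X_i.

(** The linear change of coordinates replacing the first variable by the sum of
    all variables is an automorphism, so it carries the regular sequence of the
    variables to one that begins with that sum. *)
Lemma regular_seq_sum_vars : (0 < n)%N -> exists f : nat -> R,
  [/\ f 0%N = sum_vars, forall k, (k < n)%N -> regular_at f k R^o &
      forall p, p@_0%MM = 0 <-> seq_mult f n (p : R^o)].
Proof.
move=> n0; pose i0 := Ordinal n0.
(* [s] is the change of coordinates, [t] its inverse. *)
pose s (i : 'I_n) : R := if i == i0 then sum_vars else 'X_i.
pose t (i : 'I_n) : R := if i == i0 then 'X_i0 - \sum_(j | j != i0) 'X_j else 'X_i.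
have X0 (i : 'I_n) : ('X_i : R)@_0%MM = 0 by rewrite mcoeffX mnm1_eq0.
have s0 i : (s i)@_0%MM = 0.
  rewrite /s; case: ifP => // _; rewrite raddf_sum big1 // => j _; exact: X0.
have t0 i : (t i)@_0%MM = 0.
  rewrite /t; case: ifP => // _; rewrite mcoeffB X0 raddf_sum big1 ?subr0 // => j _; exact: X0.
have fixed u (j : 'I_n) : j != i0 ->
    msubst (fun i => if i == i0 then u else 'X_i) 'X_j = 'X_j.
  by move=> /negbTE jn; rewrite msubstX jn.
have st : cancel (msubst t) (msubst s).
  apply: msubstK => i; rewrite {1}/t; case: eqVneq => [->|ni]; last exact: fixed.
  rewrite rmorphB (rmorph_sum (msubst s)) /= msubstX {1}/s eqxx /sum_vars (bigD1 i0) //=.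
  by rewrite [X in _ - X](eq_bigr _ (fun j => fixed sum_vars j)) addrK.
have ts : cancel (msubst s) (msubst t).
  apply: msubstK => i; rewrite {1}/s; case: eqVneq => [->|ni]; last exact: fixed.
  rewrite /sum_vars raddf_sum (bigD1 i0) //= msubstX {1}/t eqxx.
  by rewrite [X in _ + X](eq_bigr _ (fun j => fixed _ j)) subrK.
have transfer k (p : R) :
    seq_mult (msubst s \o mvar) k (p : R^o) <-> seq_mult mvar k (msubst t p : R^o).
  split=> [[c ec]|[c ec]].
    exists (fun i => msubst t (c i)); rewrite ec raddf_sum.
    by apply: eq_bigr => i _ /=; rewrite rmorphM /= ts.
  exists (fun i => msubst s (c i)); rewrite -[LHS]st ec raddf_sum.
  by apply: eq_bigr => i _ /=; rewrite rmorphM.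
exists (msubst s \o mvar); split=> [/=|k kn p /transfer|p].
- by rewrite -[0%N]/(val i0) mvarE msubstX /s eqxx.
- by rewrite rmorphM /= ts => /(mvar_regular kn)/transfer.
split=> [p0|/transfer/(seq_mult_mvar _ (leqnn n)) p0].
  apply/transfer/seq_mult_mvar => //.
  apply/mpolyP => m; rewrite mcoeff_mrestr mcoeff0; case: ifP => // /forallP hm.
  suff -> : m = 0%MM by rewrite msubst_mcoeff0.
  apply/mnmP => i; rewrite mnm0E; apply/eqP; move: (hm i).
  by rewrite leqNgt ltn_ord implybF negbK.
rewrite -(msubst_mcoeff0 p t0); move/(congr1 (mcoeff 0)): p0.
rewrite mcoeff_mrestr mcoeff0 ifT //; apply/forallP => i.
by rewrite mnm0E eqxx.
Qed.

End Substitution.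
(** * The length of a minimal resolution *)

Section ResolutionLength.
Variables (K : fieldType) (n : nat).
Local Notation R := {mpoly K[n]}.
Variables (M : lmodType R) (Mdeg : int -> M -> Prop) (F : free_seq K n).
Variable eps : {linear 'rV[R]_(frank F 0) -> M}.
Hypothesis resF : graded_free_resolution Mdeg eps.

(** The resolution with [M] in degree zero is exact everywhere, so that the first
    regular element, which acts on [M], is handled like the others. *)
Definition augmented_module (i : nat) : lmodType R :=
  if i is i'.+1 then 'rV[R]_(frank F i') else M.

Definition augmented_diff (i : nat) :
    {linear augmented_module i.+1 -> augmented_module i} :=
  match i return {linear augmented_module i.+1 -> augmented_module i} with
  | 0 => eps
  | i'.+1 => mulmxr (fdiff F i')
  end.

Lemma augmented_exact i (v : augmented_module i.+1) :
  augmented_diff i v = 0 <-> exists w, v = augmented_diff i.+1 w.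
Proof. by case: i v => [|i] v; [exact: (gfr_exact0 resF v)|exact: (gfr_exact resF v)]. Qed.

Hypothesis n_gt0 : (0 < n)%N.
Hypothesis sum_vars_regular : forall x : M, sum_vars K n *: x = 0 -> x = 0.
Hypothesis minF : minimal_seq F.

Lemma augmented_regular (f : nat -> R) : f 0%N = sum_vars K n ->
  (forall k, (k < n)%N -> regular_at f k R^o) ->
  forall k i, (k < n)%N -> (k <= i)%N -> regular_at f k (augmented_module i).
Proof.
move=> f0 reg k [|i] kn; last by move=> _; exact/regular_at_row/reg.
rewrite leqn0 => /eqP -> x /seq_mult0; rewrite f0 => /sum_vars_regular ->.
exact/seq_mult0.
Qed.

Lemma minimal_entry i (v : 'rV[R]_(frank F i.+1)) j :
  ((v *m fdiff F i) 0 j)@_0%MM = 0.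
Proof.
rewrite mxE raddf_sum big1 // => k _ /=.
by rewrite rmorphM /= minF mulr0.
Qed.

(** By minimality a basis vector is a cycle modulo the irrelevant ideal; its class
    vanishes in degree at least [n], although boundaries have no constant terms. *)
Lemma minimal_frank_eq0 i : (n <= i)%N -> frank F i = 0%N.
Proof.
move=> ni; have [f [f0 reg maxf]] := regular_seq_sum_vars K n_gt0.
case: (posnP (frank F i)) => // r0; pose j := Ordinal r0.
case: i ni r0 j => [|i] ni r0 j; first by move: n_gt0; rewrite ltnNge ni.
pose e : augmented_module i.+2 := delta_mx 0 j.
have : seq_mult f n (augmented_diff i.+1 e).
  by apply: seq_mult_row => k; apply/maxf/minimal_entry.
have := homology_vanishes augmented_exact (augmented_regular f0 reg) (leqnn n) ni.
move=> /[apply] -[c [w [[b ec] ee]]].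
have : (e 0 j)@_0%MM = 0.
  rewrite ee mxE mcoeffD minimal_entry addr0 ec summxE.
  apply/maxf; exists (fun i => b i 0 j).
  by apply: eq_bigr => k _; rewrite mxE.
by rewrite mxE !eqxx mcoeff1 eqxx => /eqP; rewrite oner_eq0.
Qed.

Lemma socle_frank_neq0 (u : M) :
  ~ (exists x, u = sum_vars K n *: x) ->
  (forall i, exists x, 'X_i *: u = sum_vars K n *: x) ->
  frank F n.-1 <> 0%N.
Proof.
move=> nu su r0; have [f [f0 reg maxf]] := regular_seq_sum_vars K n_gt0.
have [|||w] := @socle_climbs _ _ _ _ augmented_exact n (augmented_regular f0 reg) u n_gt0.
- by rewrite f0.
- move=> j jn; have /mcoeff0_sum_vars[c ->] : (f j)@_0%MM = 0.
    apply/maxf; exists (fun i => (i == j)%:R); rewrite (bigD1 (Ordinal jn)) //=.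
    rewrite eqxx big1 => [|i]; first by rewrite addr0 [RHS]mulr1.
    by rewrite -val_eqE /= => /negbTE ->; rewrite scaler0.
  have [x ex] := fin_all_exists su.
  exists (\sum_i c i *: x i); rewrite f0 scaler_suml scaler_sumr.
  by apply: eq_bigr => i _; rewrite mulrC -scalerA ex !scalerA mulrC.
- exact: gfr_eps_surj resF.
suff row0 k (v : augmented_module k) : (0 < k)%N -> frank F k.-1 = 0%N -> v = 0.
  by rewrite (row0 _ w n_gt0 r0) eqxx.
case: k v => // k v _ rk0.
by apply/rowP => -[j hj]; exfalso; move: hj; rewrite /= in rk0; rewrite rk0.
Qed.

Lemma max_betti_index_socle (u : M) :
  ~ (exists x, u = sum_vars K n *: x) ->
  (forall i, exists x, 'X_i *: u = sum_vars K n *: x) ->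
  max_betti_index F n.-1.
Proof.
move=> nu su; split=> [|i j].
  have /eqP := socle_frank_neq0 nu su; rewrite -lt0n => r0.
  exists (fdeg (Ordinal r0)); apply/eqP; rewrite -lt0n card_gt0.
  by apply/set0Pn; exists (Ordinal r0); rewrite inE.
move/eqP; rewrite -lt0n card_gt0 => /set0Pn[k _].
rewrite -ltnS prednK // ltnNge; apply/negP => /minimal_frank_eq0 r0.
by case: k => k hk; move: (hk); rewrite r0.
Qed.

End ResolutionLength.
(** * Edge ideals *)

Section IdealQuotient.
Variables (R : comNzRingType) (I : idealr R).

Lemma pi_ideal_eq0 (p : R) : (\pi_{ideal_quot I} p)%qT = 0 <-> p \in I.
Proof.
rewrite -[p in p \in I]subr0 Quotient.idealrBE -(rmorph0 (\pi_{ideal_quot I})%qT).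
by split=> [->|/eqP].
Qed.

Lemma pi_idealZ (a p : R) :
  a *: (\pi_{ideal_quot I} p)%qT = (\pi_{ideal_quot I} (a * p))%qT.
Proof. by rewrite rmorphM. Qed.

Lemma pi_ideal_surj (x : {ideal_quot I}) : exists p, x = (\pi_{ideal_quot I} p)%qT.
Proof. by exists (repr x); rewrite reprK. Qed.

End IdealQuotient.

Section EdgeIdealMembership.
Variables (K : fieldType) (V : finType) (L : sgraph V).
Local Notation n := #|V|.
Local Notation R := {mpoly K[n]}.
Local Notation I := (edge_ideal K L).

Definition independent (S : pred 'I_n) : Prop :=
  forall x y, adj L x y -> S (enum_rank x) -> ~~ S (enum_rank y).

Lemma edge_in_ideal x y : adj L x y -> vertex_var K x * vertex_var K y \in I.
Proof.
move=> xy; apply/edge_idealP; exists [:: (1, vertex_var K x * vertex_var K y)].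
by split=> [u|]; [rewrite inE => /eqP ->; exists x, y|rewrite big_seq1 mul1r].
Qed.

Lemma mrestr_edge_ideal S p : independent S -> p \in I -> mrestr S p = 0.
Proof.
move=> indS /edge_idealP[s [hs ->]]; rewrite raddf_sum big_seq big1 //= => u.
move/hs => [x [y [xy ->]]]; rewrite !rmorphM /= /vertex_var !mrestrX.
by case: ifP => Sx; rewrite ?(negbTE (indS _ _ xy Sx)) ?(mul0r, mulr0).
Qed.

(** A monomial outside the ideal has independent support, so it survives the
    restriction to its support. *)
Lemma edge_ideal_mrestr p :
  (forall S, independent S -> mrestr S p = 0) -> p \in I.
Proof.
move=> hp; rewrite [p]mpolyE big_seq; apply: rpred_sum => m.
rewrite mcoeff_msupp => pm.
have [[x [y [xy mx my]]]|noedge] := pselect (exists x y,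
    [/\ adj L x y, m (enum_rank x) != 0%N & m (enum_rank y) != 0%N]).
  have lem : (U_(enum_rank x) + U_(enum_rank y) <= m)%MM.
    have nxy : enum_rank x != enum_rank y.
      by apply/eqP => /enum_rank_inj e; rewrite e adj_irr in xy.
    apply/mnm_lepP => i; rewrite mnmDE !mnm1E.
    case: eqVneq => [<-|_]; first by rewrite eq_sym (negbTE nxy) lt0n.
    by case: eqVneq => [<-|]; rewrite ?lt0n.
  rewrite -(submK lem) mpolyXD mpolyXD -mul_mpolyC mulrA.
  exact/idealMr/edge_in_ideal.
case/eqP: pm; have := mcoeff_mrestr (fun i => m i != 0%N) p m.
rewrite ifT => [<-|]; last by apply/forallP => i; apply/implyP.
rewrite hp ?mcoeff0 // => x y xy mx; apply/negP => my.
by case: noedge; exists x, y.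
Qed.

Lemma independent1 (v : V) : independent (pred1 (enum_rank v)).
Proof.
move=> x y xy /eqP/enum_rank_inj ex; apply/eqP => /enum_rank_inj ey.
by rewrite ex ey adj_irr in xy.
Qed.

Lemma mrestr_sum_vars_neq0 (S : pred 'I_n) i : S i ->
  mrestr S (sum_vars K n) != 0.
Proof.
move=> Si; apply/eqP => /(congr1 (mcoeff U_(i))); rewrite mcoeff_mrestr mcoeff0.
rewrite ifT; last first.
  by apply/forallP => j; rewrite mnm1E; case: (eqVneq i j) => [<-|_] /=; rewrite ?Si.
rewrite raddf_sum (bigD1 i) //= mcoeffXU eqxx big1 => [|j /negbTE ji].
  by rewrite addr0; apply/eqP/oner_neq0.
by rewrite mcoeffXU ji.
Qed.

(** The minimal primes of an edge ideal are generated by proper subsets of the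
    variables, as a single vertex is independent; hence the sum of the variables
    lies in none of them. *)
Lemma sum_vars_edge_regular (x : {ideal_quot I}) : (0 < n)%N ->
  sum_vars K n *: x = 0 -> x = 0.
Proof.
move=> n0; have [p ->] := pi_ideal_surj x; rewrite pi_idealZ.
move=> /pi_ideal_eq0 lp; apply/pi_ideal_eq0/edge_ideal_mrestr.
have nonempty S i : independent S -> S i -> mrestr S p = 0.
  move=> indS Si; have := mrestr_edge_ideal indS lp.
  rewrite rmorphM => /eqP; rewrite mulf_eq0.
  by rewrite (negbTE (mrestr_sum_vars_neq0 Si)) => /eqP.
(* The restriction to the empty set factors through that to a single vertex. *)
move=> S indS; have [[i]|empty] := pselect (exists i, S i); first exact: nonempty.
have [v _] : exists v : V, v \in V by apply/card_gt0P.
apply/mpolyP => m; rewrite mcoeff_mrestr mcoeff0; case: ifP => // /forallP hm.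
have := congr1 (mcoeff m) (nonempty _ _ (@independent1 v) (eqxx _)).
rewrite mcoeff_mrestr mcoeff0 ifT //; apply/forallP => i; move: (hm i).
by case: (boolP (S i)) => [Si|_]; [case: empty; exists i | rewrite implybF => /negbTE ->].
Qed.

End EdgeIdealMembership.

Section JoinSocle.
Variables (K : fieldType) (V W : finType) (G : sgraph V) (H : sgraph W).
Local Notation n := #|{: V + W}|.
Local Notation L := (graph_prod G H).
Local Notation I := (edge_ideal K L).

Definition left_sum : {mpoly K[n]} := \sum_(v : V) vertex_var K (inl v : V + W).
Definition right_sum : {mpoly K[n]} := \sum_(w : W) vertex_var K (inr w : V + W).

Lemma sum_vars_join : sum_vars K n = left_sum + right_sum.
Proof.
rewrite /left_sum /right_sum -(big_sumType _ xpredT (fun z => vertex_var K z)).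
by rewrite /sum_vars (reindex (@enum_rank (V + W)%type)) //; apply/onW_bij/enum_rank_bij.
Qed.

(** A right vertex kills [left_sum] through the edges of the join. A left vertex does
    so as well, since [left_sum] is [- right_sum] modulo the sum of the variables. *)
Lemma left_sum_socle (i : 'I_n) : exists x,
  'X_i *: (\pi_{ideal_quot I} left_sum)%qT = sum_vars K n *: x.
Proof.
have -> : 'X_i = vertex_var K (enum_val i) by rewrite /vertex_var enum_valK.
case: (enum_val i) => [v|w].
  exists (\pi_{ideal_quot I} (vertex_var K (inl v)))%qT.
  rewrite !pi_idealZ sum_vars_join; apply/eqP; rewrite -Quotient.idealrBE.
  rewrite mulrC -mulrBl opprD addrA subrr add0r mulNr rpredN mulr_suml.
  by apply: rpred_sum => w _; apply: edge_in_ideal.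
exists 0; rewrite scaler0 pi_idealZ; apply/pi_ideal_eq0.
by rewrite mulr_sumr; apply: rpred_sum => v _; apply: edge_in_ideal.
Qed.

(** An equation [left_sum = sum_vars * q] modulo the edge ideal restricts to
    [x_v = x_v * q] on a left vertex and to [0 = x_w * q] on a right vertex, so the
    constant term of [q] would be both one and zero. *)
Lemma left_sum_not_multiple (v : V) (w : W) :
  ~ exists x, (\pi_{ideal_quot I} left_sum)%qT = sum_vars K n *: x.
Proof.
move=> [x]; have [q ->] := pi_ideal_surj x; rewrite pi_idealZ => /eqP.
rewrite -Quotient.idealrBE => hq.
pose S z : pred 'I_n := pred1 (enum_rank z).
have restrS z p : p \in I -> mrestr (S z) p = 0.
  exact/mrestr_edge_ideal/independent1.
have restr_var z z' : mrestr (S z) (vertex_var K z') =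
    if z' == z then vertex_var K z else 0.
  by rewrite mrestrX /S /= (inj_eq enum_rank_inj); case: eqP => [->|].
have var_neq0 z : vertex_var K z != 0 :> {mpoly K[n]}.
  apply/eqP => /(congr1 (mcoeff U_(enum_rank z))).
  by rewrite mcoeffXU eqxx mcoeff0 => /eqP; rewrite oner_eq0.
have restr_left z : mrestr (S z) left_sum =
    if z is inl _ then vertex_var K z else 0.
  rewrite raddf_sum /=; case: z => [v'|w'].
    rewrite (bigD1 v') //= restr_var eqxx big1 ?addr0 // => v2 /negbTE nv.
    by rewrite restr_var (inj_eq (@inl_inj _ _)) nv.
  by rewrite big1 // => v2 _; rewrite restr_var.
have restr_sum z : mrestr (S z) (sum_vars K n) = vertex_var K z.
  rewrite /sum_vars raddf_sum (bigD1 (enum_rank z)) //= mrestrX /S /= eqxx.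
  by rewrite big1 ?addr0 // => i /negbTE ni; rewrite mrestrX /= ni.
have := restrS (inl v) _ hq; have := restrS (inr w) _ hq.
rewrite !rmorphB !rmorphM /= !restr_sum !restr_left sub0r => /eqP.
rewrite oppr_eq0 mulf_eq0 (negbTE (var_neq0 _)) /= => /eqP qw /eqP.
rewrite -{1}[vertex_var K _]mulr1 -mulrBr mulf_eq0 (negbTE (var_neq0 _)) /=.
rewrite subr_eq0 => /eqP qv.
have const z : (mrestr (S z) q)@_0%MM = q@_0%MM.
  by rewrite mcoeff_mrestr ifT //; apply/forallP => i; rewrite mnm0E.
have := const (inl v); rewrite -(const (inr w)) qw -qv mcoeff0 mcoeff1 eqxx.
by move/eqP; rewrite oner_eq0.
Qed.

End JoinSocle.
(** * Finite generation over polynomial rings *)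

Section Noetherian.
Variables (K : fieldType) (n : nat).
Local Notation R := {mpoly K[n]}.

(** Dickson's lemma, one coordinate at a time. Suppose that in the first [k]
    coordinates every element of [P] lies above one of finitely many. An element
    for which this fails in the next coordinate is smaller there than one of these
    finitely many, so it belongs to one of finitely many slices of [P]. *)
Lemma dickson_prefix k (P : 'X_{1..n} -> Prop) : exists s : seq 'X_{1..n},
  (forall m, m \in s -> P m) /\
  forall m, P m -> exists2 m', m' \in s & forall i : 'I_n, (i < k)%N -> (m' i <= m i)%N.
Proof.
elim: k P => [|k IH] P.
  have [[m Pm]|noP] := pselect (exists m, P m).
    exists [:: m]; split=> [m'|m' _]; first by rewrite inE => /eqP ->.
    by exists m; rewrite ?mem_head.
  by exists [::]; split=> // m Pm; case: noP; exists m.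
have [s0 [Ps0 dom0]] := IH P.
pose coord (m : 'X_{1..n}) := if insub k is Some i then m i else 0%N.
have [t ht] := choice (fun b => IH (fun m => P m /\ coord m = b)).
pose B := (\max_(m <- s0) coord m)%N.
exists (s0 ++ flatten [seq t b | b <- iota 0 B]); split=> [m|m Pm].
  rewrite mem_cat => /orP[/Ps0 //|/flatten_mapP[b _ mb]].
  by have [/(_ _ mb)[]] := ht b.
have coordE (i : 'I_n) (m' : 'X_{1..n}) : i = k :> nat -> coord m' = m' i.
  by move=> ik; rewrite /coord -ik valK.
have [Bm|mB] := leqP B (coord m).
  have [m' m's dom] := dom0 m Pm; exists m' => [|i]; first by rewrite mem_cat m's.
  rewrite ltnS leq_eqVlt => /orP[/eqP ik|]; last exact: dom.
  rewrite -(coordE i m ik) -(coordE i m' ik); apply: leq_trans Bm.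
  exact: leq_bigmax_seq.
have [Pt /(_ m (conj Pm erefl))[m' m't dom]] := ht (coord m).
exists m' => [|i].
  rewrite mem_cat; apply/orP; right; apply/flatten_mapP.
  by exists (coord m); rewrite ?mem_iota.
rewrite ltnS leq_eqVlt => /orP[/eqP ik|]; last exact: dom.
by rewrite -(coordE i m ik) -(coordE i m' ik); have [_ ->] := Pt _ m't.
Qed.

Lemma dickson (P : 'X_{1..n} -> Prop) : exists s : seq 'X_{1..n},
  (forall m, m \in s -> P m) /\
  forall m, P m -> exists2 m', m' \in s & (m' <= m)%MM.
Proof.
have [s [Ps dom]] := dickson_prefix n P; exists s; split=> // m /dom[m' m's le].
by exists m' => //; apply/mnm_lepP => i; apply: le.
Qed.

Lemma mlead_reduction (p g : R) : p != 0 -> g != 0 -> (mlead g <= mlead p)%MM ->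
  exists a, p - a * g = 0 \/ (mlead (p - a * g) < mlead p)%O.
Proof.
move=> p0 g0 le; pose c := p@_(mlead p) / g@_(mlead g).
have gl0 : g@_(mlead g) != 0 by rewrite mleadc_eq0.
have c0 : c != 0 by rewrite mulf_neq0 ?invr_eq0 // mleadc_eq0.
pose a : R := c *: 'X_[mlead p - mlead g]; exists a; set q := p - a * g.
have [->|q0] := eqVneq q 0; [by left|right].
have X0 : 'X_[mlead p - mlead g] != 0 :> R.
  apply/eqP => /(congr1 (mcoeff (mlead p - mlead g))).
  by rewrite mcoeffX eqxx mcoeff0 => /eqP; rewrite oner_eq0.
have a0 : a != 0 by rewrite scaler_eq0 negb_or c0.
have la : mlead a = (mlead p - mlead g)%MM by rewrite mleadZ // mleadXm.
have lag : mlead (a * g) = mlead p by rewrite mleadM // la submK.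
have qp : q@_(mlead p) = 0.
  rewrite mcoeffB -{2}(submK le) -{1}la mleadcM la mcoeffZ mcoeffX eqxx mulr1.
  by rewrite divfK // subrr.
have : (mlead q <= mlead p)%O.
  by apply: le_trans (mleadB_le _ _) _; rewrite lag leUx lexx.
rewrite le_eqVlt => /orP[/eqP e|//].
by move: q0; rewrite -mleadc_eq0 e qp eqxx.
Qed.

Definition submod r (Z : 'rV[R]_r -> Prop) : Prop :=
  Z 0 /\ forall a v w, Z v -> Z w -> Z (a *: v + w).

Lemma submod_combination r (Z : 'rV[R]_r -> Prop) k (D : 'M[R]_(k, r)) w :
  submod Z -> (forall i, Z (row i D)) -> Z (w *m D).
Proof.
move=> [Z0 Zlin] ZD; rewrite mulmx_sum_row; apply: (big_ind Z) => // [u v Zu Zv|i _].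
  by rewrite -[u]scale1r; apply: Zlin.
by rewrite -[_ *: _]addr0; apply: Zlin.
Qed.

Definition generated r (Z : 'rV[R]_r -> Prop) : Prop :=
  exists k (D : 'M[R]_(k, r)),
    (forall i, Z (row i D)) /\ forall v, Z v -> exists w, v = w *m D.

(** Hilbert's basis theorem: by Dickson's lemma the leading monomials of finitely
    many elements divide all the others, and division by these elements leaves no
    remainder. *)
Lemma ideal_generated (Z : 'rV[R]_1 -> Prop) : submod Z -> generated Z.
Proof.
move=> [Z0 Zlin]; have scal (v : 'rV[R]_1) : v = (v 0 0)%:M by exact: mx11_scalar.
pose lead m := exists p : R, [/\ Z p%:M, p != 0 & mlead p = m].
have [s [ls dom]] := dickson lead.
have /choice[g hg] : forall m, exists g : R,
    m \in s -> [/\ Z g%:M, g != 0 & mlead g = m].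
  move=> m; case: (boolP (m \in s)) => [/ls[p hp]|_]; first by exists p.
  by exists 0.
exists (size s), (\col_i g (tnth (in_tuple s) i)); split=> [i|v].
  have [] := hg _ (mem_tnth i (in_tuple s)).
  by rewrite [X in _ -> _ -> _ -> Z X]scal !mxE.
rewrite (scal v); move: (v 0 0) => p {v}.
elim/mleadrect: p => p IH Zp.
have [->|p0] := eqVneq p 0.
  by exists 0; rewrite mul0mx; apply/rowP => i; rewrite !mxE mul0rn.
have [|m ms le] := dom (mlead p); first by exists p.
have [Zg g0 lg] := hg m ms.
have [|a red] := mlead_reduction p0 g0; first by rewrite lg.
have eq_sc : (p - a * g m)%:M = - a *: (g m)%:M + p%:M :> 'rV[R]_1.
  by rewrite scale_scalar_mx -raddfD addrC mulNr.
have [w ew] : exists w : 'rV_(size s),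
    (p - a * g m)%:M = w *m (\col_i g (tnth (in_tuple s) i)).
  case: red => [->|lt]; last by apply: IH lt _; rewrite eq_sc; apply: Zlin.
  by exists 0; rewrite mul0mx; apply/rowP => i; rewrite !mxE mul0rn.
have ms' : (index m s < size s)%N by rewrite index_mem.
exists (w + a *: delta_mx 0 (Ordinal ms')); rewrite mulmxDl -ew -scalemxAl -rowE.
have -> : row (Ordinal ms') (\col_i g (tnth (in_tuple s) i)) = (g m)%:M.
  by apply/rowP => i; rewrite !mxE (tnth_nth m) /= nth_index // ord1.
by rewrite scale_scalar_mx -raddfD subrK.
Qed.

(** Induction on the rank: the first coordinates form an ideal, and the elements
    with first coordinate zero a submodule of smaller rank. *)
Lemma submod_generated r (Z : 'rV[R]_r -> Prop) : submod Z -> generated Z.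
Proof.
elim: r Z => [|r IH] Z [Z0 Zlin].
  by exists 0%N, 0; split=> [[]//|v _]; exists 0; rewrite [v]thinmx0 mulmx0.
have [|k1 [D1 [ZD1 genD1]]] :=
  @ideal_generated (fun p => exists v, Z (row_mx p v : 'rV_(1 + r))).
  split=> [|a p q [v Zv] [w Zw]]; first by exists 0; rewrite row_mx0.
  by exists (a *: v + w); rewrite -add_row_mx -scale_row_mx; apply: Zlin.
have [|k2 [D2 [ZD2 genD2]]] := IH (fun v => Z (row_mx (0 : 'rV_1) v : 'rV_(1 + r))).
  split=> [|a v w Zv Zw]; first by rewrite row_mx0.
  have <- : a *: row_mx 0 v + row_mx 0 w = row_mx (0 : 'rV_1) (a *: v + w).
    by rewrite scale_row_mx add_row_mx scaler0 addr0.
  exact: Zlin.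
have /fin_all_exists[e he] := ZD1.
pose E : 'M[R]_(k1, r) := \matrix_i e i.
pose D : 'M[R]_(k1 + k2, 1 + r) := col_mx (row_mx D1 E) (row_mx 0 D2).
have ZD : forall i, Z (row i D).
  move=> i; case: (split_ordP i) => j ->; rewrite ?rowKu ?rowKd row_row_mx.
    by rewrite rowK.
  by rewrite row0.
exists (k1 + k2)%N, D; split=> // v Zv.
pose v' : 'rV_(1 + r) := v.
have [|w1 ew1] := genD1 (lsubmx v'); first by exists (rsubmx v'); rewrite hsubmxK.
have [|w2 ew2] := genD2 (rsubmx v' - w1 *m E).
  have -> : row_mx 0 (rsubmx v' - w1 *m E) = -1 *: (row_mx w1 0 *m D) + v'.
    rewrite mul_row_col mul_mx_row mul0mx addr0 -[X in _ = _ + X]hsubmxK.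
    by rewrite scale_row_mx add_row_mx !scaleN1r ew1 addNr addrC.
  by apply: (Zlin) => //; exact: (submod_combination _ (conj Z0 Zlin) ZD).
exists (row_mx w1 w2); suff : v' = row_mx w1 w2 *m D by [].
rewrite -[LHS]hsubmxK mul_row_col !mul_mx_row mulmx0.
by rewrite add_row_mx addr0 -ew1 -ew2 addrC subrK.
Qed.

Definition spanned r (Z : 'rV[R]_r -> Prop) (v : 'rV[R]_r) : Prop :=
  exists k (D : 'M[R]_(k, r)), (forall i, Z (row i D)) /\ exists w, v = w *m D.

(** Each of finitely many generators is a combination of finitely many elements
    of the spanning set [Y], so finitely many elements of [Y] suffice. *)
Lemma generated_spanned r (Z Y : 'rV[R]_r -> Prop) : generated Z ->
  (forall v, Z v -> spanned Y v) -> exists k (D : 'M[R]_(k, r)),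
    (forall i, Y (row i D)) /\ forall v, Z v -> exists w, v = w *m D.
Proof.
move=> [k0 [D0 [ZD0 gen]]] span.
suff [k [D [hD [W eW]]]] : exists k (D : 'M[R]_(k, r)),
    (forall i, Y (row i D)) /\ exists W, D0 = W *m D.
  exists k, D; split=> // v /gen[w ->]; exists (w *m W).
  by rewrite eW mulmxA.
elim: k0 D0 ZD0 {gen} => [|k0 IH] D0 ZD0.
  by exists 0%N, 0; split=> [[]//|]; exists 0; rewrite [D0]flatmx0 mulmx0.
pose D0' : 'M[R]_(1 + k0, r) := D0.
have [|k1 [D1 [hD1 [W1 eW1]]]] := IH (dsubmx D0').
  by move=> i; rewrite row_dsubmx; apply: ZD0.
have [|k2 [D2 [hD2 [w2 ew2]]]] := span (usubmx D0').
  by rewrite -[usubmx _](row_id 0) row_usubmx; apply: ZD0.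
exists (k2 + k1)%N, (col_mx D2 D1); split=> [i|].
  by case: (split_ordP i) => j ->; rewrite ?rowKu ?rowKd.
exists (block_mx w2 0 0 W1 : 'M_(1 + k0, _)).
suff : D0' = block_mx w2 0 0 W1 *m col_mx D2 D1 by [].
by rewrite mul_block_col !mul0mx addr0 add0r -ew2 -eW1 vsubmxK.
Qed.

End Noetherian.
(** * Homogeneous components *)

Section Homogeneous.
Variables (K : fieldType) (n : nat).
Local Notation R := {mpoly K[n]}.
Implicit Types (p q : R) (t : int).

Lemma zhomogP t p :
  zhomog t p <-> forall m, p@_m != 0 -> t = (mdeg m)%:Z.
Proof.
split; case: t => k /=.
- by move/dhomogP => hp m pm; rewrite hp // mcoeff_msupp.
- by move=> -> m; rewrite mcoeff0 eqxx.
- by move=> hp; apply/dhomogP => m; rewrite mcoeff_msupp => /hp[].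
by move=> hp; apply/mpolyP => m; rewrite mcoeff0; apply: contraPeq hp => pm /(_ _ pm).
Qed.

Lemma zhomog0 t : zhomog t (0 : R).
Proof. by apply/zhomogP => m; rewrite mcoeff0 eqxx. Qed.

Lemma zhomog_sum t (J : Type) (s : seq J) (P : pred J) (p : J -> R) :
  (forall j, P j -> zhomog t (p j)) -> zhomog t (\sum_(j <- s | P j) p j).
Proof.
move=> hp; apply: (big_ind (zhomog t)) => //; first exact: zhomog0.
move=> x y /zhomogP hx /zhomogP hy; apply/zhomogP => m; rewrite mcoeffD.
by have [->|/hx //] := eqVneq x@_m 0; rewrite add0r => /hy.
Qed.

Lemma zhomogM s t p q : zhomog s p -> zhomog t q -> zhomog (s + t) (p * q).
Proof.
case: s => s /= hp; last by rewrite hp mul0r => _; apply: zhomog0.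
case: t => t /= hq; last by rewrite hq mulr0; apply: zhomog0.
exact: dhomogM.
Qed.

Lemma zhomog_mcoeff0 t p : zhomog t p -> p@_0%MM != 0 -> t = 0 /\ p = (p@_0%MM)%:MP.
Proof.
move=> /zhomogP hp p0; have t0 : t = 0 by rewrite (hp _ p0) mdeg0.
split=> //; apply/mpolyP => m; rewrite mcoeffC.
have [->|m0] := eqVneq m 0%MM; first by rewrite mulr1.
rewrite mulr0; apply: contraNeq m0 => /hp; rewrite t0 => /eqP.
by rewrite eq_sym -mdeg_eq0.
Qed.

Definition zcomp t p : R := \sum_(m <- msupp p | t == (mdeg m)%:Z) p@_m *: 'X_[m].

Lemma mcoeff_zcomp t p m : (zcomp t p)@_m = if t == (mdeg m)%:Z then p@_m else 0.
Proof.
have pm : p@_m = \sum_(m' <- msupp p) p@_m' * (m' == m)%:R.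
  rewrite {1}[p]mpolyE raddf_sum; apply: eq_bigr => m' _ /=.
  by rewrite mcoeffZ mcoeffX.
rewrite raddf_sum big_mkcond /= {1}pm; case: ifP => tm; last first.
  rewrite big1 // => m' _; case: ifP => // tm'; rewrite mcoeffZ mcoeffX.
  by case: (eqVneq m' m) tm' => [->|_ _]; rewrite ?tm ?mulr0.
apply: eq_bigr => m' _; case: ifP => tm'; first by rewrite mcoeffZ mcoeffX.
by case: (eqVneq m' m) tm' => [->|_ _]; rewrite ?tm ?mulr0.
Qed.

Lemma zcomp_sum t (J : Type) (s : seq J) (P : pred J) (p : J -> R) :
  zcomp t (\sum_(j <- s | P j) p j) = \sum_(j <- s | P j) zcomp t (p j).
Proof.
apply/mpolyP => m; rewrite mcoeff_zcomp !(raddf_sum (mcoeff m)); case: ifP => tm.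
  by apply: eq_bigr => j _ /=; rewrite mcoeff_zcomp tm.
by rewrite big1 // => j _ /=; rewrite mcoeff_zcomp tm.
Qed.

Lemma zcomp0 t : zcomp t 0 = 0.
Proof. by rewrite /zcomp msupp0 big_nil. Qed.

Lemma zcomp_zhomog s t p : zhomog t p -> zcomp s p = if s == t then p else 0.
Proof.
move=> /zhomogP hp; apply/mpolyP => m; rewrite mcoeff_zcomp.
have [pm|/hp ->] := eqVneq p@_m 0; first by rewrite pm; do 2!case: ifP; rewrite ?mcoeff0.
by case: ifP; rewrite ?mcoeff0.
Qed.

Lemma zhomog_zcomp t p : zhomog t (zcomp t p).
Proof.
by apply/zhomogP => m; rewrite mcoeff_zcomp; case: ifP => [/eqP //|_]; rewrite eqxx.
Qed.

Lemma free_deg_mulmx r (q : nat) (a : 'I_r -> int) (b : 'I_q -> int) (D : 'M[R]_(r, q)) t v :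
  (forall i, free_deg b (a i) (row i D)) -> free_deg a t v -> free_deg b t (v *m D).
Proof.
move=> hD hv j; rewrite mxE; apply: zhomog_sum => i _.
have -> : t - b j = (t - a i) + (a i - b j) by rewrite addrA subrK.
by apply: zhomogM; [exact: hv | have := hD i j; rewrite mxE].
Qed.

Section FreeModule.
Variables (r : nat) (a : 'I_r -> int).

Definition hcomp t (v : 'rV[R]_r) : 'rV[R]_r := \row_j zcomp (t - a j) (v 0 j).

Lemma free_deg_hcomp t v : free_deg a t (hcomp t v).
Proof. by move=> j; rewrite mxE; apply: zhomog_zcomp. Qed.

Definition hdegrees (v : 'rV[R]_r) : seq int :=
  undup (flatten [seq [seq a j + (mdeg m)%:Z | m <- msupp (v 0 j)] | j <- enum 'I_r]).

Lemma sum_hcomp v : v = \sum_(t <- hdegrees v) hcomp t v.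
Proof.
apply/rowP => j; apply/mpolyP => m; rewrite summxE (raddf_sum (mcoeff m)).
rewrite (eq_bigr (fun t => if t - a j == (mdeg m)%:Z then (v 0 j)@_m else 0));
  last by move=> t _ /=; rewrite mxE mcoeff_zcomp.
have [v0|vm] := eqVneq (v 0 j)@_m 0.
  by rewrite v0 big1 // => t _; case: ifP.
have dm : a j + (mdeg m)%:Z \in hdegrees v.
  rewrite mem_undup; apply/flatten_mapP; exists j; rewrite ?mem_enum //.
  by apply/mapP; exists m; rewrite ?mcoeff_msupp.
rewrite (bigD1_seq _ dm (undup_uniq _)) /= addrAC subrr add0r eqxx big1 ?addr0 // => t.
by rewrite addrC -subr_eq => /negbTE ->.
Qed.

(** The components of a kernel element of a graded map lie in the kernel, as
    their images have distinct degrees. *)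
Lemma hcomp_kernel (q : nat) (b : 'I_q -> int) (D : 'M[R]_(r, q)) v t :
  (forall i, free_deg b (a i) (row i D)) ->
  v *m D = 0 -> t \in hdegrees v -> hcomp t v *m D = 0.
Proof.
move=> hD vD tv; have degD s := free_deg_mulmx hD (free_deg_hcomp s v).
apply/rowP => j; rewrite [RHS]mxE.
have <- : zcomp (t - b j) ((v *m D) 0 j) = 0 by rewrite vD mxE zcomp0.
rewrite [in RHS](sum_hcomp v) mulmx_suml summxE zcomp_sum.
rewrite (bigD1_seq _ tv (undup_uniq _)) /= (zcomp_zhomog _ (degD t j)) eqxx.
rewrite big1 ?addr0 // => s st; rewrite (zcomp_zhomog _ (degD s j)).
by rewrite (inj_eq (addIr _)) eq_sym (negbTE st).
Qed.

End FreeModule.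

End Homogeneous.
(** * Minimal graded free resolutions exist *)

Section Existence.
Variables (K : fieldType) (n : nat).
Local Notation R := {mpoly K[n]}.

Definition homogeneous_in r (a : 'I_r -> int) (Z : 'rV[R]_r -> Prop) (g : 'rV[R]_r) :=
  Z g /\ exists t, free_deg a t g.

Lemma redundant_generator q r (D : 'M[R]_(q.+1, r)) (w x : 'rV_q.+1) j c :
  w *m D = 0 -> w 0 j = c%:MP -> c != 0 -> exists y, x *m D = y *m row' j D.
Proof.
move=> wD wj c0; pose y := x - (x 0 j * (c^-1)%:MP) *: w.
have yD : x *m D = y *m D.
  by rewrite mulmxBl -scalemxAl wD scaler0 subr0.
have yj : y 0 j = 0.
  by rewrite !mxE wj -mulrA -mpolyCM mulVf // mpolyC1 mulr1 subrr.
exists (col' j y); rewrite yD; apply/rowP => k; rewrite !mxE (bigD1_ord j) //=.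
by rewrite yj mul0r add0r; apply: eq_bigr => i _; rewrite !mxE.
Qed.

(** Choose the least possible number of homogeneous generators. A homogeneous
    relation with a coefficient outside the irrelevant ideal has a nonzero
    constant there, so that generator would be redundant. *)
Lemma minimal_generators r (a : 'I_r -> int) (Z : 'rV[R]_r -> Prop) :
  submod Z -> (forall v, Z v -> spanned (homogeneous_in a Z) v) ->
  exists q (b : 'I_q -> int) (D : 'M[R]_(q, r)),
    [/\ forall i, Z (row i D), forall i, free_deg a (b i) (row i D),
        forall v, Z v -> exists w, v = w *m D &
        forall t w j, free_deg b t w -> w *m D = 0 -> (w 0 j)@_0%MM = 0].
Proof.
move=> subZ spanZ.
have [q0 [D0 hD0]] := generated_spanned (submod_generated subZ) spanZ.
pose gens q := exists D : 'M[R]_(q, r),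
  (forall i, homogeneous_in a Z (row i D)) /\ forall v, Z v -> exists w, v = w *m D.
have : exists q, `[< gens q >] by exists q0; apply/asboolP; exists D0.
case/ex_minnP => q /asboolP[D [hD genD]] minq.
have /fin_all_exists[b hb] : forall i, exists t, free_deg a t (row i D).
  by move=> i; have [] := hD i.
exists q, b, D; split=> // [i|t w j hw wD]; first by have [] := hD i.
apply/eqP/negPn/negP => wj; have [_ ew] := zhomog_mcoeff0 (hw j) wj.
case: q D hD genD minq b hb w j hw wD wj ew => [|q] D hD genD minq b hb w j; first by case: j.
move=> _ wD wj ew; suff : (q < q)%N by rewrite ltnn.
apply: minq; apply/asboolP.
exists (row' j D); split=> [i|v /genD[x ->]].
  have -> : row i (row' j D) = row (lift j i) D by apply/rowP => k; rewrite !mxE.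
  exact: hD.
exact: redundant_generator wD ew wj.
Qed.

(** The state of the construction: the last free module built, with the submodule
    that the next differential must have as its image. *)
Record stage := Stage {
  stage_rank : nat;
  stage_deg : 'I_stage_rank -> int;
  stage_sub : 'rV[R]_stage_rank -> Prop
}.

(** The last condition makes the next differential minimal. *)
Definition resolvable (x : stage) : Prop :=
  [/\ submod (@stage_sub x),
      forall v, @stage_sub x v -> spanned (homogeneous_in (@stage_deg x) (@stage_sub x)) v &
      forall v j, @stage_sub x v -> (v 0 j)@_0%MM = 0].

Record cover (r : nat) := Cover {
  cover_rank : nat;
  cover_deg : 'I_cover_rank -> int;
  cover_mx : 'M[R]_(cover_rank, r)
}.

Definition kernel_stage r (y : cover r) : stage :=
  Stage (@cover_deg r y) (fun v => v *m cover_mx y = 0).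

Definition covers (x : stage) (y : cover (stage_rank x)) : Prop :=
  [/\ forall i, free_deg (@stage_deg x) (cover_deg i) (row i (cover_mx y)),
      forall v, @stage_sub x v <-> exists w, v = w *m cover_mx y &
      resolvable (kernel_stage y)].

Lemma resolvable_cover x : resolvable x -> exists y, covers (x := x) y.
Proof.
case: x => r a Z [/= subZ spanZ mZ].
have [q [b [D [ZD degD genD minD]]]] := minimal_generators subZ spanZ.
have kerspan v : v *m D = 0 ->
    spanned (homogeneous_in b (fun v => v *m D = 0)) v.
  move=> vD; pose T := hdegrees b v.
  exists (size T), (\matrix_(i < size T) hcomp b T`_i v); split=> [i|].
    rewrite rowK; split; last by exists T`_i; apply: free_deg_hcomp.
    by apply: hcomp_kernel vD _ => //; apply: mem_nth.
  exists (const_mx 1); rewrite mulmx_sum_row {1}[v](sum_hcomp b).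
  rewrite (big_nth 0) big_mkord; apply: eq_bigr => i _.
  by rewrite mxE scale1r rowK.
exists (Cover b D); split=> //= [v|].
  by split=> [/genD //|[w ->]]; apply: submod_combination.
split=> //= [|v j /kerspan[k [E [hE [w ->]]]]].
  split=> [|c v w vD wD]; first exact: mul0mx.
  by rewrite mulmxDl -scalemxAl vD wD scaler0 addr0.
rewrite mxE raddf_sum big1 // => i _ /=; rewrite rmorphM /=.
have [ED [t hE']] := hE i; have := minD t (row i E) j hE' ED.
by rewrite mxE => ->; rewrite mulr0.
Qed.

(** Totality in [x] lets the iteration run on bare stages, with their resolvability
    proved afterwards. *)
Lemma cover_choice (x : stage) :
  exists y : cover (stage_rank x), resolvable x -> covers y.
Proof.
have [/resolvable_cover[y cy]|nx] := pselect (resolvable x); first by exists y.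
by exists (Cover (fun=> 0) (0 : 'M_(0, _))).
Qed.

Definition next_cover (x : stage) : cover (stage_rank x) :=
  projT1 (cid (cover_choice x)).

Lemma next_coverP x : resolvable x -> covers (next_cover x).
Proof. exact: projT2 (cid (cover_choice x)). Qed.

Section Iteration.
Variable x0 : stage.
Hypothesis x0_resolvable : resolvable x0.

Definition nth_stage (i : nat) : stage :=
  iter i (fun x => kernel_stage (next_cover x)) x0.

Definition iterated_resolution : free_seq K n :=
  FreeSeq (frank := fun i => stage_rank (nth_stage i))
    (fun i => @stage_deg (nth_stage i))
    (fun i => cover_mx (next_cover (nth_stage i))).

Lemma nth_stage_resolvable i : resolvable (nth_stage i).
Proof. by elim: i => //= i /next_coverP[]. Qed.

Lemma nth_coverP i : covers (next_cover (nth_stage i)).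
Proof. exact/next_coverP/nth_stage_resolvable. Qed.

Lemma iterated_resolution_minimal : minimal_seq iterated_resolution.
Proof.
move=> i j k; have [_ subE _] := nth_coverP i.
have [_ _ mZ] := nth_stage_resolvable i.
have := mZ (row j (fdiff iterated_resolution i)) k; rewrite mxE; apply.
by apply/subE; exists (delta_mx 0 j); rewrite -rowE.
Qed.

Lemma iterated_resolutionP (M : lmodType R) (Mdeg : int -> M -> Prop)
    (eps : {linear 'rV[R]_(stage_rank x0) -> M}) :
  (forall t v, free_deg (@stage_deg x0) t v -> Mdeg t (eps v)) ->
  (forall x, exists v, eps v = x) -> (forall v, eps v = 0 <-> stage_sub v) ->
  minimal_graded_free_resolution Mdeg iterated_resolution.
Proof.
move=> epsdeg surj ker; split; first exact: iterated_resolution_minimal.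
exists eps; split=> // [i t v|v|i v].
- by apply: free_deg_mulmx; have [] := nth_coverP i.
- by rewrite ker; have [_ ->] := nth_coverP 0.
- by have [_ subE _] := nth_coverP i.+1; apply: subE.
Qed.

End Iteration.
End Existence.

Section EdgeIdealResolution.
Variables (K : fieldType) (V : finType) (L : sgraph V).
Local Notation R := {mpoly K[#|V|]}.
Local Notation I := (edge_ideal K L).

Definition edge_stage : stage K #|V| :=
  Stage (fun _ : 'I_1 => 0) (fun v : 'rV[R]_1 => v 0 0 \in I).

Lemma edge_ideal_mcoeff0 p : p \in I -> p@_0%MM = 0.
Proof.
have ind0 : independent L pred0 by [].
move=> /(mrestr_edge_ideal ind0)/(congr1 (mcoeff 0)).
by rewrite mcoeff_mrestr mcoeff0 ifT //; apply/forallP => i; rewrite mnm0E.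
Qed.

Lemma edge_stage_resolvable : resolvable edge_stage.
Proof.
split=> /= [|v|v j vI]; last by rewrite ord1; apply: edge_ideal_mcoeff0.
  split=> [|a v w vI wI]; first by rewrite mxE rpred0.
  by rewrite !mxE rpredD // idealMr.
move=> /edge_idealP[s [hs ev]]; pose e (i : 'I_(size s)) := tnth (in_tuple s) i.
exists (size s), (\col_i (e i).2); split=> [i|].
  have [x [y [xy exy]]] := hs _ (mem_tnth i (in_tuple s)).
  split=> [|]; first by rewrite !mxE exy; apply: edge_in_ideal.
  exists 2%:Z => j; rewrite subr0 !mxE exy; apply: (@dhomogM _ _ _ 1 _ 1);
  by rewrite dhomogX /= mdeg1.
exists (\row_i (e i).1); apply/rowP => j; rewrite ord1 ev mxE.
rewrite (big_nth 0) big_mkord; apply: eq_bigr => i _.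
by rewrite !mxE /e (tnth_nth 0).
Qed.

Definition quot_eps (v : 'rV[R]_1) : {ideal_quot I} := (\pi_{ideal_quot I} (v 0 0))%qT.

Lemma quot_eps_linear : linear quot_eps.
Proof. by move=> a v w; rewrite /quot_eps !mxE rmorphD pi_idealZ. Qed.

HB.instance Definition _ := GRing.isLinear.Build R _ _ _ quot_eps quot_eps_linear.

Lemma edge_resolution_exists :
  exists F, minimal_graded_free_resolution (quot_deg I) F.
Proof.
exists (iterated_resolution edge_stage).
apply: (iterated_resolutionP edge_stage_resolvable (eps := quot_eps)).
- by move=> t v /(_ 0); rewrite subr0 => hv; exists (v 0 0).
- by move=> x; have [p ->] := pi_ideal_surj x; exists p%:M; rewrite /= /quot_eps mxE eqxx.
- by move=> v; apply: pi_ideal_eq0.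
Qed.

End EdgeIdealResolution.
Local Close Scope ring_scope.

Theorem corollary3p10 (K : fieldType) (V W : finType)
    (G : sgraph V) (H : sgraph W) (m n : nat)
    (hV : #|V| = m) (hW : #|W| = n) (hm : 1 <= m) (hn : 1 <= n) :
  has_pd {ideal_quot (edge_ideal K (graph_prod G H))}
    (quot_deg (edge_ideal K (graph_prod G H))) (m + n - 1).
Proof.
split; first exact: edge_resolution_exists.
move=> F [minF [eps resF]].
have VW : (0 < #|{: V + W}|)%N by rewrite card_sum hV addn_gt0 hm.
have [v _] : exists v : V, v \in V by apply/card_gt0P; rewrite hV.
have [w _] : exists w : W, w \in W by apply/card_gt0P; rewrite hW.
rewrite subn1 -hV -hW -card_sum.
apply: (max_betti_index_socle resF VW _ minF (left_sum_not_multiple v w)).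
  by move=> x; apply: sum_vars_edge_regular.
exact: left_sum_socle.
Qed.
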